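(* There exists a constant $c>0$ such that for every positive integer $n$ there exists a family of $n$ lines in $\mathbb{R}^3$ whose intersection graph is triangle-free and has chromatic number at least $c\,n^{1/15}$.
   Context: The intersection graph of a family $\mathcal{F}$ of sets is the graph with vertex set $\mathcal{F}$ in which two distinct members are adjacent if and only if they have nonempty intersection. *)

(* Defs.v *)
From HB Require Import structures.
From mathcomp Require Import all_boot all_order all_algebra finmap.
From mathcomp Require Import boolp classical_sets reals exp.

Set Implicit Arguments.
Unset Strict Implicit.
Unset Printing Implicit Defensive.

Import Order.TTheory GRing.Theory Num.Theory.
Local Open Scope classical_set_scope.
Local Open Scope ring_scope.

Record sgraph := SGraph {
  vertex :> finType;
  adj : rel vertex;
  adj_sym : symmetric adj;
  adj_irrefl : irreflexive adj }.

Definition triangle_free (G : sgraph) : Prop :=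
  ~ exists x y z : G, [/\ adj x y, adj y z & adj x z].

Definition colorable (G : sgraph) (k : nat) : bool :=
  [exists f : {ffun G -> 'I_k}, [forall x, forall y, adj x y ==> (f x != f y)]].

Lemma colorable_card (G : sgraph) : exists k, colorable G k.
Proof.
exists #|G|; apply/existsP; exists [ffun x => enum_rank x].
apply/forallP => x; apply/forallP => y; apply/implyP => xy.
rewrite !ffunE (inj_eq enum_rank_inj).
by apply: contraTneq xy => ->; rewrite adj_irrefl.
Qed.

Definition chromatic_number (G : sgraph) : nat := ex_minn (colorable_card G).

Definition meets (T : Type) (F : {fset (set T)}) : rel F :=
  fun A B => (A != B) && `[< val A `&` val B !=set0 >].

Lemma meets_sym (T : Type) (F : {fset (set T)}) : symmetric (@meets T F).
Proof. by move=> A B; rewrite /meets eq_sym setIC. Qed.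

Lemma meets_irrefl (T : Type) (F : {fset (set T)}) : irreflexive (@meets T F).
Proof. by move=> A; rewrite /meets eqxx. Qed.

Definition intersection_graph (T : Type) (F : {fset (set T)}) : sgraph :=
  SGraph (@meets_sym T F) (@meets_irrefl T F).

Definition is_line (R : realType) (d : nat) (L : set 'rV[R]_d) : Prop :=
  exists p v : 'rV[R]_d, v != 0 /\ L = [set p + t *: v | t in [set: R]].

(* Main.v *)
Require Import Defs.
From mathcomp Require Import all_boot all_order all_algebra finmap.
From mathcomp Require Import boolp classical_sets reals exp.
From mathcomp Require Import sequences zify ring lra.
From mathcomp Require Import fintype finset.

(** Consider the lines {(t, u + t x, v + t x^2)} with integers 0 <= x < A,
    0 <= u < T A, 0 <= v < T A^2. Each passes through T points of a grid of
    O(T^3 A^3) points, so in every set of at least a constant times T^2 A^3 of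
    these T^2 A^4 lines some line meets T others. A container-type recursion then
    bounds the number of independent sets of given size m. On the other hand, as
    the directions lie on a conic, pairwise meeting lines are concurrent, so a
    triangle is determined by one of its lines, the other two slopes and one more
    coordinate, which makes triangles rare. With T = A^7, a random sample of density
    1/(2 A^5) thus contains, after deleting a line from each triangle, at least
    A^13 / 4 lines, and no 19 A^12 pairwise disjoint ones; its chromatic number is
    at least A / 76. *)

Set Implicit Arguments.
Unset Strict Implicit.
Unset Printing Implicit Defensive.

Import Order.TTheory GRing.Theory Num.Theory.
Local Open Scope ring_scope.

(** * Counting independent sets *)

Section StableSets.
Variables (V : finType) (e : rel V).
Hypothesis eirr : irreflexive e.

Definition stable (I : {set V}) : bool :=
  [forall a in I, forall b in I, ~~ e a b].

Definition nbrs (C : {set V}) (a : V) : {set V} := [set b in C | e a b].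

Lemma stableP (I : {set V}) :
  reflect {in I &, forall a b, ~~ e a b} (stable I).
Proof.
apply: (iffP forall_inP) => [H a b aI bI|H a aI].
  by have /forall_inP/(_ b bI) := H a aI.
by apply/forall_inP => b bI; apply: H.
Qed.

Lemma stableS (I J : {set V}) : I \subset J -> stable J -> stable I.
Proof.
move=> /subsetP IJ /stableP H; apply/stableP => a b /IJ aJ /IJ bJ; exact: H.
Qed.

Section Weight.
Variables (R : realFieldType) (l : R).
Hypothesis l0 : 0 <= l.

(** The independence polynomial, at [l], of the graph induced on [C]. *)
Definition stable_weight (C : {set V}) : R :=
  \sum_(I : {set V} | (I \subset C) && stable I) l ^+ #|I|.

Lemma stable_weight_mono (B C : {set V}) :
  B \subset C -> stable_weight B <= stable_weight C.
Proof.
move=> BC; rewrite /stable_weight [leRHS](bigID (fun I : {set V} => I \subset B)) /=.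
rewrite [X in _ <= X + _](eq_bigl (fun I : {set V} => (I \subset B) && stable I)).
  by rewrite lerDl; apply: sumr_ge0 => I _; apply: exprn_ge0.
move=> I; case: (boolP (I \subset B)) => [IB|]; last by rewrite andbF.
by rewrite (fintype.subset_trans IB BC) andbT.
Qed.

(** Split by whether [v] belongs to [I]; removing [v] from such an [I] leaves an independent set
    free of neighbours of [v]. Equality can fail because [e] need not be symmetric. *)
Lemma stable_weight_rec (C : {set V}) (v : V) : v \in C ->
  stable_weight C <=
  stable_weight (C :\ v) + l * stable_weight ((C :\ v) :\: nbrs C v).
Proof.
move=> vC; rewrite {1}/stable_weight (bigID (fun I : {set V} => v \in I)) /= addrC.
apply: lerD.
  rewrite /stable_weight le_eqVlt; apply/orP; left; apply/eqP; apply: eq_bigl => I.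
  by rewrite subsetD1 -!andbA; congr andb; rewrite andbC.
rewrite (reindex_onto (fun J => v |: J) (fun I => I :\ v)) /=; last first.
  by move=> I /andP[_ vI]; rewrite setD1K.
rewrite /stable_weight mulr_sumr.
(* The conditions left by the reindexing select some terms of the right-hand sum; the others are
   nonnegative. *)
rewrite [leRHS](bigID (fun J : {set V} =>
  ((v |: J \subset C) && stable (v |: J) && (v \in v |: J) &&
           ((v |: J) :\ v == J)))) /=.
apply: ler_wpDr; first by apply: sumr_ge0 => I _; rewrite mulr_ge0 ?exprn_ge0.
rewrite le_eqVlt; apply/orP; left; apply/eqP.
apply: eq_big => [J|J /andP[_ /eqP JE]]; last first.
  have vJ : v \notin J by rewrite -JE !inE eqxx.
  by rewrite cardsU1 vJ exprS.
apply/idP/idP => [H|/andP[] //]; rewrite H andbT.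
case/andP: H => /andP[/andP[sub st] _] /eqP JE.
rewrite (stableS (subsetUr _ _) st) andbT -JE.
apply/subsetP => b; rewrite !inE => /andP[bv]; rewrite (negPf bv) /= => bJ.
have bC : b \in C by rewrite (subsetP sub) // !inE bJ orbT.
rewrite bC /= andbT; apply: (stableP _ st); by rewrite !inE ?eqxx ?bJ ?orbT.
Qed.

(** An equality for edgeless graphs; it ends the recursion below once [C] has at most [r]
    vertices. *)
Lemma stable_weight_le1D (C : {set V}) : stable_weight C <= (1 + l) ^+ #|C|.
Proof.
move: {2}#|C| (erefl #|C|) => c; elim: c C => [|c IH] C cC.
  rewrite cC (cards0_eq cC) /stable_weight (big_pred1 set0) ?cards0 // => I.
  rewrite subset0 /=; have [->|//] := eqVneq I set0.
  by apply/stableP => a b; rewrite inE.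
have /card_gt0P[v vC] : (0 < #|C|)%N by rewrite cC.
have cCv : #|C :\ v| = c by move: (cardsD1 v C); rewrite vC cC => -[].
apply: le_trans (stable_weight_rec vC) _.
rewrite cC exprS mulrDl mul1r; apply: lerD; first by have := IH _ cCv; rewrite cCv.
apply: ler_wpM2l => //; apply: le_trans (stable_weight_mono (subsetDl _ _)) _.
by rewrite -cCv IH.
Qed.

(* Branching on a vertex of high degree: the recursion f(c) = f(c-1) + l f(c-1-D)
   has the solution x^c as a supersolution. *)
Lemma stable_weight_le (r D : nat) (x : R) : 1 <= x -> l <= x ^+ D * (x - 1) ->
  (forall C : {set V}, (r < #|C|)%N -> exists2 v, v \in C & (D <= #|nbrs C v|)%N) ->
  forall C, stable_weight C <= (1 + l) ^+ r * x ^+ #|C|.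
Proof.
move=> x1 lx Hdeg C; move: {2}#|C| (leqnn #|C|) => c.
elim: c C => [|c IH] C cC.
  have c0 : #|C| = 0%N by apply/eqP; rewrite -leqn0.
  apply: le_trans (stable_weight_le1D _) _; rewrite c0 !expr0 mulr1.
  by apply: exprn_ege1; rewrite lerDl.
case: (leqP #|C| r) => [Cr|/Hdeg [v vC dv]].
  apply: le_trans (stable_weight_le1D _) _.
  apply: (@le_trans _ _ ((1 + l) ^+ r)).
    by apply: ler_weXn2l => //; rewrite lerDl.
  by rewrite ler_peMr ?exprn_ege1 // exprn_ge0 // addr_ge0.
have cCv : #|C| = #|C :\ v|.+1 by rewrite (cardsD1 v C) vC.
have sub : nbrs C v \subset C :\ v.
  apply/subsetP => b; rewrite !inE => /andP[-> eb]; rewrite andbT.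
  by apply: contraTneq eb => ->; rewrite eirr.
have cD : #|(C :\ v) :\: nbrs C v| = (#|C :\ v| - #|nbrs C v|)%N.
  by rewrite cardsD (setIidPr sub).
have leD := subset_leq_card sub.
apply: le_trans (stable_weight_rec vC) _.
have H1 := IH (C :\ v) ltac:(lia).
have H2 := IH ((C :\ v) :\: nbrs C v) ltac:(lia).
have l1 : 0 <= (1 + l) ^+ r by rewrite exprn_ge0 // addr_ge0.
have x0 : 0 <= x by apply: le_trans x1.
have H3 : stable_weight ((C :\ v) :\: nbrs C v) <=
    (1 + l) ^+ r * x ^+ (#|C :\ v| - D).
  apply: le_trans H2 _; apply: ler_wpM2l => //; apply: ler_weXn2l => //; lia.
rewrite cCv; have [k kE] : exists k, #|C :\ v| = (k + D)%N.
  by exists (#|C :\ v| - D)%N; lia.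
rewrite kE addnK in H3; rewrite kE in H1 *.
(* Up to the common factor [(1 + l) ^+ r * x ^+ k], the claim is [x ^+ D + l <= x ^+ D.+1], which is
   [lx]. *)
apply: le_trans (lerD H1 (ler_wpM2l l0 H3)) _.
rewrite mulrCA -mulrDr; apply: ler_wpM2l => //.
rewrite exprS exprD.
have : 0 <= x ^+ k by rewrite exprn_ge0.
move: (x ^+ k) (x ^+ D) lx => y z lx y0.
have := ler_wpM2r y0 lx; lra.
Qed.

End Weight.

(** Each independent set of size [m] contributes [l ^+ m] to the weight of the full vertex set. *)
Lemma card_stable_le (R : realFieldType) (l : R) (r D m : nat) (x : R) :
  0 < l -> 1 <= x -> l <= x ^+ D * (x - 1) ->
  (forall C : {set V}, (r < #|C|)%N -> exists2 v, v \in C & (D <= #|nbrs C v|)%N) ->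
  #|[set I : {set V} | stable I & #|I| == m]|%:R <=
    l ^- m * ((1 + l) ^+ r * x ^+ #|V|).
Proof.
move=> l0 x1 lx Hdeg.
have /= := stable_weight_le (ltW l0) x1 lx Hdeg setT; rewrite cardsT => H.
rewrite mulrC ler_pdivlMr ?exprn_gt0 //; apply: le_trans H.
rewrite /stable_weight (bigID (fun I : {set V} => #|I| == m)) /=.
apply: ler_wpDr; first by apply: sumr_ge0 => I _; rewrite exprn_ge0 // ltW.
rewrite (eq_bigr (fun=> l ^+ m)); last by move=> I /andP[_ /eqP ->].
rewrite sumr_const mulr_natl le_eqVlt; apply/orP; left; apply/eqP.
congr (_ *+ _); apply: eq_card => I; by rewrite !inE unfold_in subsetT.
Qed.

End StableSets.

(** * Random sampling *)

Lemma subset_of_card (T : finType) (A : {set T}) (k : nat) :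
  (k <= #|A|)%N -> exists2 B : {set T}, B \subset A & #|B| = k.
Proof.
move=> /card_geqP[s [us <- sA]]; exists [set x in s].
  by apply/subsetP => x; rewrite inE => /sA.
by rewrite cardsE; apply/card_uniqP.
Qed.

Section Sampling.
Variables (V : finType) (e : rel V).
Hypothesis eirr : irreflexive e.

(** Ordered triples; irreflexivity of [e] makes their entries distinct. *)
Definition triangles (S : {set V}) : {set V * V * V} :=
  [set z | [&& z.1.1 \in S, z.1.2 \in S & z.2 \in S] &&
           [&& e z.1.1 z.1.2, e z.1.2 z.2 & e z.1.1 z.2]].

Variable Q : nat.

(** For uniform [f], each vertex is kept independently with probability [1 / Q.+1]; sums over all
    [f] play the role of expectations. *)
Definition sample (f : {ffun V -> 'I_Q.+1}) : {set V} := [set v | f v == ord0].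

(** The values of [f] are forced on [I] and free elsewhere. *)
Lemma card_sample_sup (R : realFieldType) (I : {set V}) :
  #|[set f | I \subset sample f]|%:R = Q.+1%:R ^+ #|V| / Q.+1%:R ^+ #|I| :> R.
Proof.
have Q0 : Q.+1%:R != 0 :> R by rewrite pnatr_eq0.
apply: (mulIf (expf_neq0 #|I| Q0)); rewrite divfK ?expf_neq0 // -!natrX -natrM.
congr _%:R.
have -> : #|[set f | I \subset sample f]| =
    #|family (fun v => if v \in I then pred1 (@ord0 Q) else predT)|.
  apply: eq_card => f; rewrite !inE; apply/subsetP/familyP => H v.
    by case: ifP => // /H; rewrite !inE.
  by move=> vI; have := H v; rewrite vI !inE.
rewrite card_family foldrE big_image /= -(cardsC I) expnD mulnC; congr muln.
rewrite (bigID (mem I)) /= big1 ?mul1n.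
  rewrite (eq_bigr (fun=> Q.+1)) ?prod_nat_const.
    by congr expn; apply: eq_card => v; rewrite !inE.
  by move=> v /negPf ->; rewrite card_ord.
by move=> v ->; rewrite card1.
Qed.

(** Linearity of expectation, as a double count of pairs of [f] and [j]. *)
Lemma sum_card_sample (R : realFieldType) (J : finType) (A : {set J})
    (I : J -> {set V}) (k : nat) :
  {in A, forall j, #|I j| = k} ->
  \sum_(f : {ffun V -> 'I_Q.+1}) #|[set j in A | I j \subset sample f]|%:R =
  #|A|%:R * (Q.+1%:R ^+ #|V| / Q.+1%:R ^+ k) :> R.
Proof.
move=> Ik.
transitivity (\sum_(f : {ffun V -> 'I_Q.+1}) \sum_(j in A) (I j \subset sample f)%:R : R).
  apply: eq_bigr => f _; rewrite -natr_sum -big_mkcondr sum1_card /=.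
  by congr _%:R; apply: eq_card => j; rewrite !inE.
rewrite exchange_big /= mulr_natl -sumr_const.
apply: eq_bigr => j /Ik <-; rewrite -card_sample_sup -natr_sum -big_mkcond sum1_card /=.
by congr _%:R; apply: eq_card => f; rewrite !inE.
Qed.

Definition stables (m : nat) : {set {set V}} := [set I | stable e I & #|I| == m].

(** Deletion method: from a sample with few triangles and no independent set of size [m], remove one
    vertex of each triangle. *)
Lemma exists_sparse_sample (R : realFieldType) (m : nat) :
  (0 < #|V|)%N ->
  (4 * #|triangles setT| <= Q.+1 ^ 2 * #|V|)%N ->
  (4 * Q.+1)%:R * #|stables m|%:R <= Q.+1%:R ^+ m :> R ->
  exists S : {set V}, [/\ triangles S = set0,
    forall I : {set V}, I \subset S -> stable e I -> (#|I| < m)%N &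
    (#|V| <= 2 * Q.+1 * #|S|)%N].
Proof.
move=> V0 Htri Hst.
pose tri f := #|triangles (sample f)|.
pose ind f := #|[set I in stables m | I \subset sample f]|.
(* On average the right side is [2 * #|V|], while the last two terms on the left are at most
   [#|V| / 2] each. *)
have [f Hf] : exists f, (#|V| + 2 * Q.+1 * tri f + 2 * Q.+1 * #|V| * ind f <=
    2 * Q.+1 * #|sample f|)%N.
  apply: contrapT => /forallNP H.
  pose q : R := Q.+1%:R; pose v : R := #|V|%:R.
  have {}H f : 2 * q * #|sample f|%:R + 1 <=
      v + 2 * q * (tri f)%:R + 2 * q * v * (ind f)%:R.
    rewrite /q /v -!natrM -!natrD natr1 ler_nat ltnNge; apply/negP; exact: H.
  have Q0 : 0 < q by rewrite ltr0n.
  pose N := q ^+ #|V|.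
  have N0 : 0 < N by rewrite exprn_gt0.
  have E1 : \sum_f #|sample f|%:R = v * (N / q).
    have := @sum_card_sample R V setT (fun v => [set v]) 1%N (fun v _ => cards1 v).
    rewrite expr1 cardsT => <-; apply: eq_bigr => f _; congr _%:R.
    by apply: eq_card => w; rewrite !inE sub1set inE.
  have E2 : \sum_f (tri f)%:R = #|triangles setT|%:R * (N / q ^+ 3).
    have := @sum_card_sample R _ (triangles setT)
      (fun z => [set z.1.1; z.1.2; z.2]) 3%N.
    move=> <-; last first.
      move=> [[a b] c]; rewrite !inE /= => /and3P[ab bc ac].
      have neq x y : e x y -> x != y by apply: contraTneq => ->; rewrite eirr.
      by rewrite setUC cardsU1 cards2 !inE neq // (eq_sym c) (eq_sym c) negb_or !neq.
    apply: eq_bigr => f _; congr _%:R; apply: eq_card => -[[a b] c].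
    rewrite !inE /= !subUset !sub1set !inE -!andbA; do !bool_congr.
  have E3 : \sum_f (ind f)%:R = #|stables m|%:R * (N / q ^+ m).
    have := @sum_card_sample R _ (stables m) (fun I => I) m.
    move=> <-; last by move=> I; rewrite inE => /andP[_ /eqP].
    by apply: eq_bigr => f _; congr _%:R; apply: eq_card => I; rewrite !inE.
  have Hsum := ler_sum (P := predT) (index_enum _) (fun f _ => H f).
  move: Hsum; rewrite !big_split /= -!mulr_sumr !sumr_const E1 E2 E3.
  have -> : #|xpredT : pred {ffun V -> 'I_Q.+1}| = (Q.+1 ^ #|V|)%N.
    by rewrite card_ffun card_ord.
  rewrite -[v *+ _]mulr_natr natrX -/q -/N.
  have v0 : 0 < v by rewrite ltr0n.
  set t : R := #|triangles _|%:R; set s : R := #|stables m|%:R.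
  have {}Htri : 4 * t <= q ^+ 2 * v.
    by move: Htri; rewrite -(ler_nat R) natrM [leRHS]natrM natrX.
  have {}Hst : 4 * q * s <= q ^+ m by move: Hst; rewrite natrM.
  clearbody N q v t s => {H E1 E2 E3}.
  have qN0 : q != 0 by rewrite gt_eqF.
  have -> : 2 * q * (v * (N / q)) = 2 * v * N by field.
  have Ht : 2 * q * (t * (N / q ^+ 3)) <= v * N / 2.
    have -> : 2 * q * (t * (N / q ^+ 3)) = (2 * t / q ^+ 2) * N by field.
    rewrite [leRHS]mulrAC ler_pM2r // ler_pdivrMr ?exprn_gt0 //; lra.
  have Hs : 2 * q * v * (s * (N / q ^+ m)) <= v * N / 2.
    have -> : 2 * q * v * (s * (N / q ^+ m)) = (2 * q * s / q ^+ m) * (v * N).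
      by field; rewrite expf_neq0.
    rewrite mulrC ler_pM2l ?mulr_gt0 // ler_pdivrMr ?exprn_gt0 //; lra.
  lra.
(* A single independent set of size [m] would push the left side of [Hf] past [2 * Q.+1 * #|V|]. *)
have ind0 : ind f = 0%N.
  apply/eqP; rewrite -leqn0 leqNgt; apply/negP => ind1.
  have : (#|sample f| <= #|V|)%N by apply: max_card.
  nia.
rewrite ind0 muln0 addn0 in Hf.
pose B := [set z.1.1 | z in triangles (sample f)].
have leB : (#|B| <= tri f)%N by apply: leq_imset_card.
exists (sample f :\: B); split.
- apply/setP => z; rewrite !inE; apply/negP => /and4P[/and3P[z1 z2 z3] e1 e2 e3].
  case/andP: z1 => /negP zB z1; apply: zB; apply/imsetP; exists z => //.
  case/andP: z2 => _ z2; case/andP: z3 => _ z3.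
  by rewrite !inE z1 z2 z3 e1 e2 e3.
- move=> I IS st.
  rewrite ltnNge; apply/negP => /subset_of_card[J JI cJ].
  have : J \in [set I in stables m | I \subset sample f].
    rewrite !inE (stableS JI st) cJ eqxx /=.
    by rewrite (subset_trans (subset_trans JI IS)) ?subsetDl.
  by rewrite (cards0_eq ind0) inE.
- have : (#|sample f| <= #|sample f :\: B| + #|B|)%N.
    by rewrite -(cardsID B) addnC leq_add2l subset_leq_card // subsetIr.
  nia.
Qed.
End Sampling.

(** * A dense system of concurrences *)

Section IncidenceDegree.
Local Open Scope nat_scope.
Variables (V Pt : finType) (e : rel V) (T : nat) (pt : V -> 'I_T -> Pt).
Hypothesis pt_inj : forall a b i j, pt a i = pt b j -> i = j.
Hypothesis pt_adj : forall a b i, a != b -> pt a i = pt b i -> e a b.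
Hypothesis pt_unique : forall a b i j,
  a != b -> pt a i = pt b i -> pt a j = pt b j -> i = j.

(* With d P the number of lines of C through P, the sum of d P is T|C| and the sum
   of d P ^ 2 is at most T|C| plus the sum of the degrees; compare them through
   3 d <= d ^ 2 + 2. *)
Lemma incidence_degree (C : {set V}) :
  0 < #|C| -> 2 * #|Pt| <= #|C| * T ->
  exists2 a, a \in C & T <= #|nbrs e C a|.
Proof.
move=> C0 PC; apply: contrapT => H.
have {}H a : a \in C -> #|nbrs e C a| < T.
  by move=> aC; rewrite ltnNge; apply/negP => Ta; apply: H; exists a.
pose d P := \sum_(a in C) \sum_(i < T) (pt a i == P).
have pt_sum a (f : Pt -> nat) i : \sum_P (pt a i == P) * f P = f (pt a i).
  rewrite (bigD1 (pt a i)) //= eqxx mul1n big1 ?addn0 // => P.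
  by rewrite eq_sym => /negPf ->.
have d_sum f : \sum_P d P * f P = \sum_(a in C) \sum_(i < T) f (pt a i).
  under eq_bigr do rewrite big_distrl /=.
  rewrite exchange_big /=; apply: eq_bigr => a _.
  under eq_bigr do rewrite big_distrl /=.
  by rewrite exchange_big /=; apply: eq_bigr => i _; apply: pt_sum.
have Sd : \sum_P d P = #|C| * T.
  have := d_sum (fun=> 1); under eq_bigr do rewrite muln1; move=> ->.
  rewrite -(sum_nat_const (mem C)); apply: eq_bigr => a _.
  by rewrite /= sum1_card card_ord.
(* Every degree is at most [T - 1]; the saved [#|C|] makes the last comparison strict. *)
have Sdd : \sum_P d P * d P + #|C| <= 2 * (#|C| * T).
  rewrite d_sum -[X in _ + X <= _]sum1_card -big_split /= mulnCA -(sum_nat_const (mem C)).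
  apply: leq_sum => a aC.
  suff : \sum_(i < T) d (pt a i) <= T + #|nbrs e C a|.
    by move=> le; apply: leq_trans (leq_add le (leqnn 1)) _; have := H a aC; lia.
  have -> : \sum_(i < T) d (pt a i) = \sum_(b in C) \sum_(i < T) (pt b i == pt a i).
    rewrite exchange_big /=; apply: eq_bigr => b _.
    apply: eq_bigr => i _; rewrite (bigD1 i) //= big1 ?addn0 // => j ji.
    by apply/eqP; rewrite eqb0; apply: contraNneq ji => /pt_inj ->.
  rewrite (bigD1 a) //=; apply: leq_add.
    by under eq_bigr do rewrite eqxx; rewrite sum1_card card_ord.
  rewrite -sum1_card [leqRHS](eq_bigl (fun b => (b \in C) && e a b)); last first.
    by move=> b; rewrite inE.
  rewrite big_mkcondr [leqRHS]big_mkcondr /=; apply: leq_sum => b _.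
  (* Distinct lines share at most one point, so the inner sum is at most 1, and it is 0 unless
     [e a b]. *)
  case: ifP => // ba; have [/existsP[i /eqP bi]|/existsPn none] :=
    boolP [exists i, pt b i == pt a i].
    rewrite (@pt_adj a b i) // 1?eq_sym // (bigD1 i) //= bi eqxx big1 ?addn0 //.
    move=> j ji; apply/eqP; rewrite eqb0; apply: contraNneq ji => bj.
    by rewrite (pt_unique ba bj bi).
  by rewrite big1 // => i _; rewrite (negPf (none i)).
have : 3 * \sum_P d P <= \sum_P d P * d P + 2 * #|Pt|.
  rewrite -sum1_card !big_distrr /= -big_split /=; apply: leq_sum => P _.
  by case: (d P) => [|[|k]] //; nia.
lia.
Qed.
End IncidenceDegree.

(** * Lines with directions on a conic *)

Section Lines.
Variables A T : nat.
Local Notation V := ('I_A * 'I_(T * A) * 'I_(T * A ^ 2))%type.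

(* (x, u, v) stands for the line {(t, u + t x, v + t x^2)}; equating two such points
   and eliminating t gives the condition for meeting. *)
Definition concurrent (a b : V) : bool :=
  (a.1.1 != b.1.1) &&
  (a.2%:Z - b.2%:Z == (a.1.2%:Z - b.1.2%:Z) * (a.1.1%:Z + b.1.1%:Z)).

Lemma concurrent_irr : irreflexive concurrent.
Proof. by move=> a; rewrite /concurrent eqxx. Qed.

(** The map [g] keeps the first line, the slopes of the other two and the [u] of the second; the
    meeting conditions then give [v1], [u2] and [v2] in turn. *)
Lemma card_triangles :
  (#|triangles concurrent setT| <= #|{: V}| * (A * A * (T * A)))%N.
Proof.
pose g (z : V * V * V) := (z.1.1, (z.1.2.1.1, z.2.1.1, z.1.2.1.2)).
rewrite -(card_in_imset (f := g)).
  by apply: leq_trans (max_card _) _; rewrite !card_prod !card_ord.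
move=> [[[[x u] v] [[x1 u1] v1]] [[x2 u2] v2]].
move=> [[[[y s] w] [[y1 s1] w1]] [[y2 s2] w2]].
rewrite !inE /concurrent /= => /and3P[/andP[n1 /eqP E1] /andP[n2 /eqP E2] /andP[n3 /eqP E3]].
move=> /and3P[/andP[m1 /eqP F1] /andP[m2 /eqP F2] /andP[m3 /eqP F3]].
rewrite /g /= => -[? ? ? ? ? ?]; subst y s w y1 y2 s1.
have v1E : v1 = w1 by apply: val_inj => /=; lia.
(* Eliminating the [v] coordinates from the three conditions leaves an equation linear in [u2], with
   coefficient [x1 - x] up to sign. *)
have u2E : u2 = s2.
  apply: val_inj => /=; suff : u2%:Z = s2%:Z by lia.
  have n10 : x1%:Z - x%:Z != 0.
    by rewrite subr_eq0; apply: contraNneq n1 => n1; apply/eqP/val_inj => /=; lia.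
  apply: (mulIf n10); lia.
subst w1 s2; have -> // : v2 = w2 by apply: val_inj => /=; lia.
Qed.

Lemma grid_ltn (n x i k : nat) : (x <= A ^ k)%N -> (n < T * A ^ k)%N -> (i < T)%N ->
  (n + i * x < 2 * (T * A ^ k))%N.
Proof.
move=> xA nT iT; rewrite mul2n -addnn -addSn; apply: leq_add => //.
by apply: leq_mul => //; apply: ltnW.
Qed.

(** The point at parameter [i]; writing [A ^ 1] lets [grid_ltn] bound both coordinates. *)
Definition line_point (a : V) (i : 'I_T) :
    'I_T * 'I_(2 * (T * A ^ 1)) * 'I_(2 * (T * A ^ 2)) :=
  (i, Ordinal (grid_ltn (k := 1) (ltnW (ltn_ord a.1.1)) (ltn_ord a.1.2) (ltn_ord i)),
   Ordinal (grid_ltn (k := 2) (leq_mul (ltnW (ltn_ord a.1.1)) (ltnW (ltn_ord a.1.1)))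
     (ltn_ord a.2) (ltn_ord i))).

Lemma line_point_eq (a b : V) (i j : 'I_T) : line_point a i = line_point b j ->
  [/\ i = j, (a.1.2 + i * a.1.1 = b.1.2 + i * b.1.1)%N &
     (a.2 + i * a.1.1 ^ 2 = b.2 + i * b.1.1 ^ 2)%N].
Proof. by move=> -[-> e1 e2]; split. Qed.

Lemma line_eq (a b : V) : a.1.1 = b.1.1 :> nat -> a.1.2 = b.1.2 :> nat ->
  a.2 = b.2 :> nat -> a = b.
Proof.
by case: a b => [[x u] v] [[y s] w] /= /val_inj -> /val_inj -> /val_inj ->.
Qed.

(** The grid has [4 * T ^ 3 * A ^ 3] points, so beyond this threshold [C] has at least twice as many
    incidences as there are points. *)
Lemma concurrent_degree (C : {set V}) : (0 < T)%N ->
  (8 * T ^ 2 * A ^ 3 < #|C|)%N ->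
  exists2 a, a \in C & (T <= #|nbrs concurrent C a|)%N.
Proof.
move=> T0 cC; apply: (incidence_degree (pt := line_point)).
- by move=> a b i j /line_point_eq[].
- move=> a b i ab /line_point_eq[_].
  case: a b ab => [[x u] v] [[y s] w] ab /= e1 e2; rewrite -(mulnn x) -(mulnn y) in e2.
  apply/andP; split => /=.
    apply: contraNneq ab => xy; apply/eqP; rewrite xy in e1 e2.
    by apply: line_eq; rewrite /= ?xy //; lia.
  have -> : u%:Z - s%:Z = i%:Z * (y%:Z - x%:Z) by lia.
  have -> : v%:Z - w%:Z = i%:Z * (y%:Z * y%:Z - x%:Z * x%:Z) by lia.
  by apply/eqP; ring.
- move=> a b i j ab /line_point_eq[_ +] + /line_point_eq[_ + _].
  case: a b ab => [[x u] v] [[y s] w] ab /= e1 e2 f1.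
  (* Lines of equal slope through a common point coincide; otherwise the second coordinates fix the
     parameter. *)
  have [xy|xy] := eqVneq x y.
    by case/eqP: ab; rewrite xy in e1 e2; apply: line_eq; rewrite /= ?xy //; lia.
  apply: val_inj => /=; suff : i%:Z = j%:Z by lia.
  have n10 : x%:Z - y%:Z != 0.
    by rewrite subr_eq0; apply: contraNneq xy => xy; apply/eqP/val_inj => /=; lia.
  by apply: (mulIf n10); lia.
- exact: leq_trans cC.
- rewrite !card_prod !card_ord; apply: leq_trans (leq_mul (ltnW cC) (leqnn T)).
  by apply: eq_leq; ring.
Qed.
End Lines.

(** * Elementary estimates and the choice of parameters *)

Lemma bernoulli (R : realFieldType) (y : R) (n : nat) :
  0 <= y -> 1 + n%:R * y <= (1 + y) ^+ n.
Proof.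
move=> y0; elim: n => [|n IH]; first by rewrite mul0r addr0 expr0.
have n0 : 0 <= n%:R :> R by [].
have := ler_wpM2l (addr_ge0 ler01 y0) IH.
have := mulr_ge0 n0 (mulr_ge0 y0 y0).
rewrite exprS -natr1; lra.
Qed.

Lemma exprD1_le_expR (R : realType) (y : R) (n : nat) :
  0 <= y -> (1 + y) ^+ n <= expR (n%:R * y).
Proof.
move=> y0; rewrite expRM_natl; apply: lerXn2r; rewrite ?nnegrE ?expR_ge0 //.
  by rewrite addr_ge0.
exact: expR_ge1Dx.
Qed.

(** This is [e <= 4], which follows from [1 - 1/2 <= expR (- 1/2)]. *)
Lemma expR_nat_le (R : realType) (n : nat) : expR n%:R <= 2 ^+ (2 * n) :> R.
Proof.
have h : expR (2^-1) <= 2 :> R.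
  have := expR_ge1Dx (- 2^-1 : R); rewrite expRN => H.
  rewrite -[expR _]invrK invf_ple ?posrE ?invr_gt0 ?expR_gt0 //; lra.
have -> : n%:R = (2 * n)%:R * 2^-1 :> R by rewrite natrM; field.
by rewrite expRM_natl; apply: lerXn2r; rewrite ?nnegrE ?expR_ge0.
Qed.

Lemma exists_sparse_lines (R : realType) (A : nat) : (1 < A)%N ->
  exists S : {set 'I_A * 'I_(A ^ 7 * A) * 'I_(A ^ 7 * A ^ 2)},
    [/\ triangles (@concurrent A (A ^ 7)) S = set0,
      forall I : {set _}, I \subset S -> stable (@concurrent A (A ^ 7)) I ->
        (#|I| < 19 * A ^ 12)%N &
      (A ^ 13 <= 4 * #|S|)%N].
Proof.
move=> A1; set e := @concurrent _ _; set m := (19 * A ^ 12)%N.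
have A0 : (0 < A)%N by apply: ltnW.
have Q0 : (0 < 2 * A ^ 5)%N by rewrite muln_gt0 expn_gt0 A0.
have [Q QE] : exists Q, (2 * A ^ 5 = Q.+1)%N by exists (2 * A ^ 5).-1; rewrite prednK.
have cV : #|{: 'I_A * 'I_(A ^ 7 * A) * 'I_(A ^ 7 * A ^ 2)}| = (A ^ 18)%N.
  by rewrite !card_prod !card_ord; ring.
have [] := @exists_sparse_sample _ e (@concurrent_irr _ _) Q R m.
- by rewrite cV expn_gt0 A0.
(* The density is chosen to make the remaining comparison an equality: both sides are
   [4 * A ^ 28]. *)
- apply: leq_trans (leq_mul (leqnn 4) (card_triangles _ _)) _.
  by rewrite cV -QE; apply: eq_leq; ring.
- have a1 : 1 < A%:R :> R by rewrite ltr1n.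
  have a0 : 0 < A%:R :> R by rewrite ltr0n.
  (* With these values [l] times [r = 8 * A ^ 17] and [x - 1] times [#|V| = A ^ 18] are both of
     order [A ^ 12], like [m]. *)
  set l : R := A%:R ^- 5; set x : R := 1 + A%:R ^- 6.
  have l0 : 0 < l by rewrite invr_gt0 exprn_gt0.
  have y0 : 0 <= A%:R ^- 6 :> R by rewrite invr_ge0 exprn_ge0 // ltW.
  have x1 : 1 <= x by rewrite lerDl.
  (* Bernoulli bounds the power of [x] below by [1 + A], and [l] is [A] times [x - 1]. *)
  have lx : l <= x ^+ (A ^ 7) * (x - 1).
    have -> : x - 1 = A%:R ^- 6 by rewrite /x; ring.
    have -> : l = A%:R * A%:R ^- 6 by rewrite /l; field; rewrite gt_eqF.
    apply: ler_wpM2r => //; apply: le_trans (bernoulli _ y0).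
    have -> : (A ^ 7)%:R * A%:R ^- 6 = A%:R :> R.
      by rewrite natrX; field; rewrite gt_eqF.
    by rewrite lerDr.
  have := card_stable_le (e := e) (@concurrent_irr _ _)
    (r := (8 * (A ^ 7) ^ 2 * A ^ 3)%N) m l0 x1 lx.
  rewrite cV => /(_ (fun C => @concurrent_degree _ _ C _)) H.
  have {}H := H ltac:(by rewrite expn_gt0 A0).
  have b1 : (1 + l) ^+ (8 * (A ^ 7) ^ 2 * A ^ 3) <= expR (8 * A ^ 12)%:R.
    have -> : (8 * A ^ 12)%:R = (8 * (A ^ 7) ^ 2 * A ^ 3)%:R * l.
      have -> : (8 * (A ^ 7) ^ 2 * A ^ 3 = 8 * A ^ 17)%N by ring.
      by rewrite [LHS]natrM [X in _ = X * _]natrM !natrX /l; field; rewrite gt_eqF.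
    exact: exprD1_le_expR (ltW l0).
  have b2 : x ^+ (A ^ 18) <= expR (A ^ 12)%:R.
    have -> : (A ^ 12)%:R = (A ^ 18)%:R * A%:R ^- 6 :> R.
      by rewrite !natrX; field; rewrite gt_eqF.
    exact: exprD1_le_expR.
  have b3 : (1 + l) ^+ (8 * (A ^ 7) ^ 2 * A ^ 3) * x ^+ (A ^ 18) <= 2 ^+ (18 * A ^ 12).
    apply: le_trans (ler_pM _ _ b1 b2) _.
    + by rewrite exprn_ge0 // addr_ge0 // ltW.
    + by rewrite exprn_ge0 // (le_trans ler01).
    rewrite -expRD -natrD; apply: le_trans (expR_nat_le _ _) _.
    by rewrite -mulSnr mulnA.
  (* Since [A >= 2], [8 * A ^ 5 <= A ^ 12 <= 2 ^ (A ^ 12)]. *)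
  have b4 : (4 * Q.+1)%:R <= 2 ^+ (A ^ 12) :> R.
    rewrite -natrX ler_nat; apply: leq_trans (ltnW (ltn_expl _ (ltnSn 1))).
    have : (2 ^ 7 <= A ^ 7)%N by rewrite leq_exp2r.
    rewrite -QE (_ : A ^ 12 = A ^ 7 * A ^ 5)%N; last by rewrite -expnD.
    by nia.
  (* The powers of 2 from [b4] and [b3] multiply to [2 ^ m], and [l ^- m] is [A ^ (5 * m)]; together
     they give exactly [Q.+1 ^ m]. *)
  apply: le_trans (ler_pM _ _ b4 (le_trans H (ler_wpM2l _ b3))) _ => //.
    by rewrite invr_ge0 exprn_ge0 // ltW.
  rewrite mulrCA -exprD -mulSn -/m -QE natrM natrX exprMn /l.
  by rewrite exprVn invrK mulrC.
move=> S [t st cS]; exists S; split=> //.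
rewrite cV -QE (_ : A ^ 18 = A ^ 5 * A ^ 13)%N in cS; last by rewrite -expnD.
rewrite (_ : 2 * (2 * A ^ 5) * #|S| = A ^ 5 * (4 * #|S|))%N in cS; last by ring.
by rewrite leq_pmul2l ?expn_gt0 ?A0 in cS.
Qed.

(** * Lines in space *)

Section SpaceLines.
Variables (R : realType) (A T : nat).
Local Notation V := ('I_A * 'I_(T * A) * 'I_(T * A ^ 2))%type.
Local Notation concurrent := (@concurrent A T).

Definition vec3 (x y z : R) : 'rV[R]_3 := \row_(i < 3) [:: x; y; z]`_i.

Lemma vec3_inj (x y z x' y' z' : R) :
  vec3 x y z = vec3 x' y' z' -> [/\ x = x', y = y' & z = z'].
Proof.
move=> /rowP H; split.
- by have := H (inord 0); rewrite !mxE inordK.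
- by have := H (inord 1); rewrite !mxE inordK.
- by have := H (inord 2); rewrite !mxE inordK.
Qed.

Lemma vec3_line (x y z a b c t : R) :
  vec3 x y z + t *: vec3 a b c = vec3 (x + t * a) (y + t * b) (z + t * c).
Proof. by apply/rowP => -[[|[|[|]]] // ?]; rewrite !mxE. Qed.

Lemma vec3_neq0 (x y z : R) : [|| x != 0, y != 0 | z != 0] -> vec3 x y z != 0.
Proof.
apply: contraTneq => v0; have : vec3 x y z = vec3 0 0 0.
  by rewrite v0; apply/rowP => -[[|[|[|]]] // ?]; rewrite !mxE.
by move=> /vec3_inj[-> -> ->]; rewrite eqxx.
Qed.

Definition line (p v : 'rV[R]_3) : set 'rV[R]_3 := [set p + t *: v | t in [set: R]]%classic.

(* The vertical lines only serve to adjust the number of lines: they lie in the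
   plane x = 0, which the other lines cross at points with y >= 0. *)
Definition space_line (n : nat) (i : V + 'I_n) : set 'rV[R]_3 :=
  match i with
  | inl a => line (vec3 0 a.1.2%:R a.2%:R) (vec3 1 a.1.1%:R (a.1.1%:R ^+ 2))
  | inr j => line (vec3 0 (- j.+1%:R) 0) (vec3 0 0 1)
  end.

Lemma space_line_is_line n (i : V + 'I_n) : is_line (space_line i).
Proof.
case: i => [a|j].
  by exists (vec3 0 a.1.2%:R a.2%:R), (vec3 1 a.1.1%:R (a.1.1%:R ^+ 2));
    split=> //; rewrite vec3_neq0 // oner_neq0.
exists (vec3 0 (- j.+1%:R) 0), (vec3 0 0 1); split=> //.
by rewrite vec3_neq0 // oner_neq0 !orbT.
Qed.

Lemma space_line_inlP n (a : V) q : space_line (n := n) (inl a) q <->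
  exists t, q = vec3 t (a.1.2%:R + t * a.1.1%:R) (a.2%:R + t * a.1.1%:R ^+ 2).
Proof.
split=> [[t _ <-]|[t ->]]; exists t => //; by rewrite vec3_line add0r mulr1.
Qed.

Lemma space_line_inrP n (j : 'I_n) q : space_line (inr j) q <->
  exists t, q = vec3 0 (- j.+1%:R) t.
Proof.
by split=> [[t _ <-]|[t ->]]; exists t => //; rewrite vec3_line !mulr0 !addr0 add0r mulr1.
Qed.

Lemma space_line_disj n (a : V) (j : 'I_n) q :
  space_line (n := n) (inl a) q -> space_line (inr j) q -> False.
Proof.
move=> /space_line_inlP[t ->] /space_line_inrP[s /vec3_inj[-> + _]].
rewrite mul0r addr0 => E; have : 0 <= a.1.2%:R :> R by [].
by rewrite E oppr_ge0 lern0.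
Qed.

(** A slanted line is recovered from its points at [t = 0] and [t = 1]. *)
Lemma space_line_inj n : injective (@space_line n).
Proof.
have mem (a : V) t : space_line (n := n) (inl a)
    (vec3 t (a.1.2%:R + t * a.1.1%:R) (a.2%:R + t * a.1.1%:R ^+ 2)).
  by apply/space_line_inlP; exists t.
move=> [a|j] [b|k] E.
- have := mem a 0; rewrite E => /space_line_inlP[s /vec3_inj[<-]].
  rewrite !mul0r !addr0 => /eqP; rewrite eqr_nat => /eqP e1 /eqP; rewrite eqr_nat => /eqP e2.
  have := mem a 1; rewrite E => /space_line_inlP[{}s /vec3_inj[<-]].
  rewrite e1 => /addrI; rewrite !mul1r => /eqP; rewrite eqr_nat => /eqP e3 _.
  by congr inl; apply: line_eq.
- have := mem a 0; rewrite E => H; case: (space_line_disj (mem a 0) H).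
- have := mem b 0; rewrite -E => H; case: (space_line_disj (mem b 0) H).
- have : space_line (inr j) (vec3 0 (- j.+1%:R) 0) by apply/space_line_inrP; exists 0.
  rewrite E => /space_line_inrP[s /vec3_inj[_ /oppr_inj/eqP + _]].
  by rewrite eqr_nat => /eqP[] /val_inj ->.
Qed.

Lemma intr_nat (k : nat) : k%:Z%:~R = k%:R :> R. Proof. by []. Qed.

(** Meetings at every real parameter count here, not only those at grid points; eliminating the
    parameter leaves an identity between integers. *)
Lemma meet_concurrent n (a b : V) : a != b ->
  (space_line (n := n) (inl a) `&` space_line (n := n) (inl b) !=set0)%classic <->
  concurrent a b.
Proof.
move=> ab; split.
  move=> [_ [/space_line_inlP[t ->] /space_line_inlP[s /vec3_inj[<- e1 e2]]]].
  apply/andP; split.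
    apply: contraNneq ab => xx; apply/eqP; move: e1 e2; rewrite xx.
    move=> /addIr/eqP; rewrite eqr_nat => /eqP e1 /addIr/eqP; rewrite eqr_nat => /eqP e2.
    by apply: line_eq => //; rewrite xx.
  apply/eqP/(@intr_inj R); rewrite rmorphM !rmorphB rmorphD /= !intr_nat.
  have -> : a.1.2%:R = b.1.2%:R + t * b.1.1%:R - t * a.1.1%:R :> R by rewrite -e1; ring.
  have -> : a.2%:R = b.2%:R + t * b.1.1%:R ^+ 2 - t * a.1.1%:R ^+ 2 :> R by rewrite -e2; ring.
  ring.
case/andP=> xx /eqP/(congr1 (fun z : int => z%:~R : R)).
rewrite rmorphM !rmorphB rmorphD /= !intr_nat => E.
have n0 : a.1.1%:R - b.1.1%:R != 0 :> R.
  by rewrite subr_eq0 eqr_nat.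
(* The parameter at which the second coordinates agree; by [E] the third ones then agree too. *)
pose t : R := (b.1.2%:R - a.1.2%:R) / (a.1.1%:R - b.1.1%:R).
exists (vec3 t (a.1.2%:R + t * a.1.1%:R) (a.2%:R + t * a.1.1%:R ^+ 2)); split.
  by apply/(@space_line_inlP n); exists t.
apply/(@space_line_inlP n); exists t; congr vec3.
  by rewrite /t; field.
have -> : a.2%:R = b.2%:R + (a.1.2%:R - b.1.2%:R) * (a.1.1%:R + b.1.1%:R) :> R.
  by rewrite -E; ring.
by rewrite /t; field.
Qed.

Lemma meet_inl n (i j : V + 'I_n) : i != j ->
  (space_line i `&` space_line j !=set0)%classic ->
  exists a b, [/\ i = inl a, j = inl b & concurrent a b].
Proof.
case: i j => [a|i] [b|j] ij.
- by move=> /meet_concurrent H; exists a, b; split=> //; apply: H.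
- by move=> [q [/space_line_disj H /H]].
- by move=> [q [/[swap] /space_line_disj H /H]].
- move=> [q [/space_line_inrP[s ->] /space_line_inrP[t /vec3_inj[_ /oppr_inj/eqP + _]]]].
  by rewrite eqr_nat => /eqP[] /val_inj e; case/eqP: ij; rewrite e.
Qed.

(** Vertical lines bring the number of lines to [n] without adding edges. Each colour class within
    [S] is stable, hence has at most [m] members. *)
Lemma padded_family (n m : nat) (S : {set V}) : (0 < n)%N -> (#|S| <= n)%N ->
  triangles concurrent S = set0 ->
  (forall I : {set V}, I \subset S -> stable concurrent I -> (#|I| <= m)%N) ->
  exists F : {fset (set 'rV[R]_3)},
    [/\ #|` F| = n,
      forall L : set 'rV[R]_3, L \in F -> is_line L,
      triangle_free (intersection_graph F),
      (0 < chromatic_number (intersection_graph F))%N &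
      (#|S| <= chromatic_number (intersection_graph F) * m)%N].
Proof.
move=> n0 Sn tS stS.
have [|B _ cB] := @subset_of_card _ [set: 'I_n] (n - #|S|)%N.
  by rewrite cardsT card_ord leq_subr.
pose J : {set V + 'I_n} := inl @: S :|: inr @: B.
have inlJ a : (inl a \in J) = (a \in S).
  rewrite inE mem_imset; last by move=> ? ? [].
  case: (a \in S) => //=; by apply/negP => /imsetP[].
pose F : {fset (set 'rV[R]_3)} := [fset space_line i | i in J]%fset.
have cF : #|` F| = n.
  rewrite /F card_imfset /=; last exact: space_line_inj.
  rewrite -cardE cardsU disjoint_setI0 ?cards0 ?subn0; last first.
    by apply/pred0P => -[x|x] /=; apply/negP => /andP[/imsetP[? _ ?] /imsetP[? _ ?]].
  by rewrite !card_imset ?cB ?subnKC // => ? ? [].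
have memF (x : F) : exists2 i, i \in J & val x = space_line i.
  by have := valP x; move=> /imfsetP[i iJ ->]; exists i.
have adjF (x y : intersection_graph F) : adj x y -> exists a b,
  [/\ a \in S, b \in S, concurrent a b,
      val x = space_line (n := n) (inl a) & val y = space_line (n := n) (inl b)].
  case/andP=> xy /asboolP; have [i iJ xi] := memF x; have [j jJ yj] := memF y.
  rewrite xi yj => /meet_inl[|a [b [ia jb ab]]].
    by apply: contraNneq xy => ij; apply/eqP/val_inj; rewrite xi yj ij.
  by exists a, b; rewrite -!inlJ -ia -jb.
exists F; split=> //.
- by move=> L /imfsetP[i _ ->]; apply: space_line_is_line.
- move=> [x [y [z [/adjF[a [b [aS bS ab xa yb]]] /adjF[b' [c [_ cS bc yb' zc]]] xz]]]].
  move: xz => /adjF[a' [c' [_ _ ac xa' zc']]].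
  have inj (a1 a2 : V) (w : F) : val w = space_line (n := n) (inl a1) ->
      val w = space_line (n := n) (inl a2) -> a1 = a2.
    by move=> -> /space_line_inj[].
  have Ea := inj _ _ _ xa xa'; have Eb := inj _ _ _ yb yb'.
  have Ec := inj _ _ _ zc zc'.
  subst a' b' c'; have : (a, b, c) \in triangles concurrent S by rewrite !inE /= aS bS cS ab bc ac.
  by rewrite tS inE.
(* A colouring without colours is impossible, as [F] is nonempty. *)
- rewrite /chromatic_number; case: ex_minnP => -[|//] /existsP[f _] _.
  have : (0 < #|` F|)%N by rewrite cF.
  by rewrite cardfs_gt0 => /fset0Pn[x xF]; case: (f [` xF]%fset).
- rewrite /chromatic_number; case: ex_minnP => k /existsP[f /forallP Hf] _.
  have memS a : a \in S -> space_line (n := n) (inl a) \in F.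
    by move=> aS; apply/imfsetP; exists (inl a) => //; rewrite /= inlJ.
  pose cl (c : 'I_k) := [set a in S |
    [exists x : F, (val x == space_line (n := n) (inl a)) && (f x == c)]].
  have Scl : S \subset \bigcup_c cl c.
    apply/subsetP => a aS; apply/bigcupP; exists (f [` memS a aS]%fset) => //.
    by rewrite inE aS; apply/existsP; exists [` memS a aS]%fset; rewrite !eqxx.
  apply: leq_trans (subset_leq_card Scl) _.
  apply: (@leq_trans (\sum_(c < k) #|cl c|)).
    elim/big_rec2: _ => [|c B' U _ le]; first by rewrite cards0.
    by apply: leq_trans (leq_card_setU _ _) _; rewrite leq_add2l.
  rewrite -[k in (k * m)%N]card_ord -sum_nat_const; apply: leq_sum => c _.
  apply: stS; first by apply/subsetP => a; rewrite inE => /andP[].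
  apply/stableP => a b; rewrite !inE.
  move=> /andP[aS /existsP[x /andP[/eqP xa /eqP fx]]].
  move=> /andP[bS /existsP[y /andP[/eqP yb /eqP fy]]].
  apply/negP => ab.
  have nab : a != b by apply: contraTneq ab => ->; rewrite concurrent_irr.
  have /forallP/(_ y)/implyP := Hf x; rewrite fx fy eqxx => /(_ _)/negP; apply => //.
  apply/andP; split.
    by apply: contraNneq nab => xy; move: yb; rewrite -xy xa => /space_line_inj[->].
  by apply/asboolP; rewrite xa yb; apply/meet_concurrent.
Qed.
End SpaceLines.

(** * Passage to arbitrary [n] *)

Theorem theorem1p1 (R : realType) :
  exists2 c : R, 0 < c &
    forall n : nat, (0 < n)%N ->
      exists F : {fset (set 'rV[R]_3)},
        [/\ #|` F| = n,
            forall L : set 'rV[R]_3, L \in F -> is_line L,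
            triangle_free (intersection_graph F) &
            c * n%:R `^ (15^-1) <= (chromatic_number (intersection_graph F))%:R].
Proof.
(* Here [152 = 2 * 76]: the root of [n] is at most [A.+1 <= 2 * A], and [A] is at most 76 times the
   chromatic number. *)
exists 152^-1 => [|n n0]; first by rewrite invr_gt0.
have [A An nA] : exists2 A, (A ^ 15 <= n)%N & (n < A.+1 ^ 15)%N.
  have ex : exists A, (A ^ 15 <= n)%N by exists 0%N; rewrite exp0n.
  have bd A : (A ^ 15 <= n)%N -> (A <= n)%N.
    by apply: leq_trans; rewrite -{1}(expn1 A); case: A => // A; rewrite leq_pexp2l.
  case: (ex_maxnP ex bd) => A An max; exists A => //.
  by rewrite ltnNge; apply/negP => /max; rewrite ltnn.
have root_le : n%:R `^ 15^-1 <= A.+1%:R :> R.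
  have -> : A.+1%:R = (A.+1%:R ^+ 15) `^ 15^-1 :> R.
    by rewrite -powR_mulrn // -powRrM mulfV ?powRr1 // pnatr_eq0.
  apply: ge0_ler_powR; rewrite ?nnegrE ?invr_ge0 ?exprn_ge0 //.
  by rewrite -natrX ler_nat ltnW.
(* In the small case the root is at most 2, so [n] vertical lines suffice. *)
have [A1|A1] := leqP A 1.
  have [] := @padded_family R 0 0 n 0 set0 n0.
  - by rewrite cards0.
  - by apply/setP => z; rewrite !inE.
  - by move=> I; rewrite subset0 => /eqP -> _; rewrite cards0.
  move=> F [cF lF tF chi0 _]; exists F; split=> //.
  have : 1 <= (chromatic_number (intersection_graph F))%:R :> R by rewrite ler1n.
  have : A.+1%:R <= 2 :> R by rewrite ler_nat ltnS.
  lra.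
have [S [tS stS cS]] := exists_sparse_lines R A1.
(* [S] may have more than [n] members; cutting it to [n] is harmless because [A ^ 13 <= n]. *)
have [S' S'S cS'] := subset_of_card (geq_minl #|S| n).
have [] := @padded_family R A (A ^ 7) n (19 * A ^ 12) S' n0.
- by rewrite cS' geq_minr.
- apply/eqP; rewrite -subset0 -tS; apply/subsetP => z; rewrite !inE.
  by move=> /andP[/and3P[z1 z2 z3] ->]; rewrite !(subsetP S'S).
- by move=> I IS' st; apply: ltnW; apply: stS => //; apply: subset_trans S'S.
move=> F [cF lF tF _ chiF]; exists F; split=> //.
(* The constant is [4 * 19], from [A ^ 13 <= 4 * #|S'|] and colour classes of size at most
   [19 * A ^ 12]. *)
have chi : (A <= 76 * chromatic_number (intersection_graph F))%N.
  move: (chromatic_number _) chiF => k chiF.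
  have A12 : (0 < A ^ 12)%N by rewrite expn_gt0 ltnW.
  rewrite -(leq_pmul2r A12) -expnS.
  have le : (A ^ 13 <= 4 * #|S'|)%N.
    rewrite cS' /minn; case: ifP => // _.
    apply: leq_trans (leq_trans An (leq_pmull n _)) => //.
    by rewrite leq_pexp2l // ltnW.
  apply: leq_trans le _; apply: leq_trans (leq_mul (leqnn 4) chiF) _.
  by apply: eq_leq; ring.
have : A.+1%:R <= 2 * A%:R :> R by rewrite -natrM ler_nat mul2n -addnn -addn1 leq_add2l ltnW.
have : A%:R <= 76 * (chromatic_number (intersection_graph F))%:R :> R.
  by rewrite -natrM ler_nat.
lra.
Qed.
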